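(* Let $G$ be a group with normal subgroup $N$, and $H$ a group with normal subgroup $K$. Let $i:N\hookrightarrow G$ be the inclusion map. Assume that $\widehat{i^*}(\mathrm{Q}(G)/\mathrm{H}^1(G))$ is norm-closed in $(\mathrm{Q}(N)^G/\mathrm{H}^1(N)^G,D_N)$, and that $\mathrm{W}(H,K)$ is finite-dimensional. Assume that $$\dim_{\mathbb{R}}\mathrm{W}(G,N)>\dim_{\mathbb{R}}\mathrm{W}(H,K).$$ Let $\varphi:G\to H$ be a group homomorphism such that $\varphi(N)\subseteq K$. Then there exists a sequence $(y_n)_{n\in\mathbb{N}}$ in $[G,N]$ satisfying $$\lim_{n\to\infty}\frac{\mathrm{scl}_{G,N}(y_n)}{\mathrm{scl}_G(y_n)}=\infty\quad\text{and}\quad\lim_{n\to\infty}\frac{\mathrm{scl}_{G,N}(y_n)}{\mathrm{scl}_{H,K}(\varphi(y_n))}=\infty.$$ Here a quotient $a/0$ with $a>0$ is understood to be $\infty$.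
   Context: Mixed scl: for $N$ normal in $G$, $[G,N]$ is the subgroup generated by $\mathcal{S}_{G,N}=\{gxg^{-1}x^{-1} : g\in G,x\in N\}$; $\mathrm{cl}_{G,N}$ is the word length on $[G,N]$ with respect to $\mathcal{S}_{G,N}$; $\mathrm{scl}_{G,N}(y)=\lim_{k\to\infty}\mathrm{cl}_{G,N}(y^k)/k$; $\mathrm{scl}_G=\mathrm{scl}_{G,G}$. Quasimorphisms: for a group $L$ and $f:L\to\mathbb{R}$, the defect is $D_L(f)=\sup\{|f(l_1l_2)-f(l_1)-f(l_2)| : l_1,l_2\in L\}$; $f$ is a quasimorphism if $D_L(f)<\infty$, and homogeneous if its restriction to every cyclic subgroup is a homomorphism. $\mathrm{Q}(L)$ is the real vector space of homogeneous quasimorphisms on $L$; $\mathrm{H}^1(L)=\mathrm{Hom}(L,\mathbb{R})$. For $N$ normal in $G$, $\mathrm{Q}(N)^G$ and $\mathrm{H}^1(N)^G$ are the subspaces of elements of $\mathrm{Q}(N)$, $\mathrm{H}^1(N)$ invariant under conjugation by $G$; $D_N$ induces a norm on $\mathrm{Q}(N)^G/\mathrm{H}^1(N)^G$. The map $\widehat{i^*}:\mathrm{Q}(G)/\mathrm{H}^1(G)\to\mathrm{Q}(N)^G/\mathrm{H}^1(N)^G$ is $[\phi]\mapsto[\phi|_N]$. Define $\mathrm{W}(G,N)=\mathrm{Q}(N)^G/(\mathrm{H}^1(N)^G+i^*\mathrm{Q}(G))$ with $i^*\phi=\phi|_N$, and $\mathrm{W}(H,K)$ likewise. $\dim_{\mathbb{R}}$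 takes values in $\mathbb{Z}_{\ge0}\cup\{\infty\}$, being $\infty$ for every infinite-dimensional space. *)

(* Defs.v *)
From HB Require Import structures.
From mathcomp Require Import all_boot all_order all_algebra.
From mathcomp Require Import all_classical all_reals ereal topology.
From mathcomp Require Import normedtype sequences ring lra.

Set Implicit Arguments.
Unset Strict Implicit.
Unset Printing Implicit Defensive.

Import Order.TTheory GRing.Theory Num.Theory.
Import numFieldNormedType.Exports.

Local Open Scope classical_set_scope.
Local Open Scope ring_scope.
Local Open Scope quotient_scope.

Section LinearAlgebra.
Variables (R : realType) (V : lmodType R).

Section Submodule.
Variable U : submodClosed V.

Record submodule : Type := Submodule {
  submod_val : V;
  _ : submod_val \in U }.

HB.instance Definition _ := [isSub for submod_val].
HB.instance Definition _ := [Choice of submodule by <:].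
HB.instance Definition _ := [SubChoice_isSubLmodule of submodule by <:].

(* [submodClosed] does not record stability under opposite. *)
Definition zmod_pred : {pred V} := fun x => x \in U.

Fact zmod_pred_closed : zmod_closed zmod_pred.
Proof.
split=> [|x y Ux Uy]; first exact: rpred0.
by rewrite -scaleN1r; apply: rpredD => //; apply: rpredZ.
Qed.
HB.instance Definition _ := GRing.isZmodClosed.Build V zmod_pred
  zmod_pred_closed.

Definition quotient : Type := Quotient.quot zmod_pred.

HB.instance Definition _ := GRing.Zmodule.on quotient.
HB.instance Definition _ := Quotient.on quotient.

Fact quot_eqP (x y : V) :
  reflect (\pi_quotient x = \pi_quotient y) (x - y \in U).
Proof. by rewrite (Quotient.idealrBE zmod_pred); apply: eqP. Qed.

Definition qscale (a : R) (q : quotient) : quotient := \pi_quotient (a *: repr q).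

Fact pi_scale a (x : V) : qscale a (\pi_quotient x) = \pi_quotient (a *: x).
Proof.
apply/quot_eqP; rewrite -scalerBr; apply: rpredZ.
by apply/quot_eqP; rewrite reprK.
Qed.

Lemma pi_quotientD (x y : V) : \pi_quotient (x + y) = \pi_quotient x + \pi_quotient y.
Proof. exact: (Quotient.pi_add zmod_pred x y). Qed.

Fact qscaleA a b q : qscale a (qscale b q) = qscale (a * b) q.
Proof. by rewrite -[q]reprK (pi_scale b) !pi_scale scalerA. Qed.

Fact qscale1 : left_id 1 qscale.
Proof. by move=> q; rewrite -[q]reprK pi_scale scale1r. Qed.

Fact qscaleDr : right_distributive qscale +%R.
Proof.
move=> a p q; rewrite -[p]reprK -[q]reprK -pi_quotientD !pi_scale scalerDr.
exact: pi_quotientD.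
Qed.

Fact qscaleDl q : {morph qscale^~ q : a b / a + b}.
Proof.
by move=> a b /=; rewrite -[q]reprK !pi_scale scalerDl; apply: pi_quotientD.
Qed.

HB.instance Definition _ := GRing.Zmodule_isLmodule.Build R quotient
  qscaleA qscale1 qscaleDr qscaleDl.

Lemma pi_quotientZ a (x : V) : \pi_quotient (a *: x) = a *: \pi_quotient x.
Proof. by rewrite -pi_scale. Qed.

Lemma pi_quotient0 : \pi_quotient (0 : V) = 0.
Proof. by rewrite -[X in \pi_quotient X](scale0r 0) pi_quotientZ scale0r. Qed.

End Submodule.

Definition is_basis n (v : 'I_n -> V) :=
  (forall c : 'I_n -> R, \sum_i c i *: v i = 0 -> forall i, c i = 0) /\
  (forall x, exists c : 'I_n -> R, x = \sum_i c i *: v i).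

Definition finite_dimensional := exists n (v : 'I_n -> V), is_basis v.

(* All bases have the same cardinality, so that [xget] makes no choice. *)
Definition dimension : \bar R :=
  xget +oo%E [set (n%:R)%:E | n in [set n | exists v : 'I_n -> V, is_basis v]].

End LinearAlgebra.

Section Subgroup.
Variable G : groupType.

Record subgroup_type (N : groupClosed G) : Type := Subgroup {
  subgroup_val : G;
  _ : subgroup_val \in N }.

HB.instance Definition _ (N : groupClosed G) := [isSub for @subgroup_val N].
HB.instance Definition _ (N : groupClosed G) :=
  [Choice of subgroup_type N by <:].
Fact group_closedP (N : groupClosed G) : group_closed N.
Proof. by split; [exact: gpred1 | exact: gpredF]. Qed.

HB.instance Definition _ (N : groupClosed G) :=
  SubChoice_isSubGroup.Build G _ (subgroup_type N) (group_closedP N).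

Definition normal_subgroup (N : {pred G}) :=
  forall g x, x \in N -> (g * x * g^-1)%g \in N.

Definition generated (S : set G) : set G :=
  smallest (fun A => group_closed [pred x | x \in A]) S.

(* Products of [n] letters, each in [S] or the inverse of an element of [S]. *)
Definition products (S : set G) (n : nat) : set G :=
  [set y | exists s : n.-tuple G,
    (forall a, a \in s -> S a \/ S a^-1%g) /\ y = (\prod_(a <- s) a)%g].

(* The default value 0 is only taken outside [generated S]. *)
Definition word_length (S : set G) (y : G) : nat :=
  xget 0%N
    [set n | products S n y /\ forall m, products S m y -> (n <= m)%N].

Definition mixed_commutators (N : {pred G}) : set G :=
  [set (g * x * g^-1 * x^-1)%g | g in [set: G] & x in [set` N]].

Definition mixed_commutator_subgroup (N : {pred G}) : set G :=
  generated (mixed_commutators N).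

Definition cl (N : {pred G}) : G -> nat := word_length (mixed_commutators N).

(* The limit exists for [y] in [mixed_commutator_subgroup N] by subadditivity.
   Taking [N] to be [predT] gives the ordinary stable commutator length.
   Quotients of values of [scl] are meant to be taken in [\bar R], where
   [0^-1 = +oo] and [0 * +oo = 0]: then [a / 0] is [+oo] for [a > 0], whereas
   [0 / 0] is [0]. *)
Definition scl (R : realType) (N : {pred G}) (y : G) : R :=
  lim (((cl N (y ^+ k)%g)%:R / k%:R : R) @[k --> \oo]).

End Subgroup.

Section Quasimorphisms.
Variables (R : realType) (L : groupType).
Implicit Types (f : L -> R) (x y : L).

Definition defect f : \bar R :=
  ereal_sup [set `|f (x * y)%g - f x - f y|%:E | x in [set: L] & y in [set: L]].

Definition quasimorphism f := (defect f < +oo)%E.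

Definition homogeneous f := forall l,
  {in generated [set l] &, forall x y, f (x * y)%g = f x + f y}.

Definition homomorphism f := forall x y, f (x * y)%g = f x + f y.

(* Q(L) is [submodule hqm]. *)
Definition hqm : {pred L -> R} :=
  fun f => `[< quasimorphism f /\ homogeneous f >].

Lemma le_defect f x y : (`|f (x * y)%g - f x - f y|%:E <= defect f)%E.
Proof. by apply: ereal_sup_ubound; exists x => //; exists y. Qed.

Lemma defect_le f C :
  (forall x y, `|f (x * y)%g - f x - f y| <= C) -> (defect f <= C%:E)%E.
Proof.
by move=> fC; apply: ge_ereal_sup => _ [x _] [y _] <-; rewrite lee_fin.
Qed.

Lemma defect_ge0 f : (0 <= defect f)%E.
Proof. by apply: le_trans (le_defect f 1%g 1%g); rewrite lee_fin. Qed.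

Lemma defect_fin_num f : quasimorphism f -> defect f \is a fin_num.
Proof. by move=> fQ; rewrite ge0_fin_numE ?defect_ge0. Qed.

Lemma le_fine_defect f x y : quasimorphism f ->
  `|f (x * y)%g - f x - f y| <= fine (defect f).
Proof.
by move=> fQ; rewrite -lee_fin fineK ?defect_fin_num //; apply: le_defect.
Qed.

Lemma fine_defect_le f C :
  (forall x y, `|f (x * y)%g - f x - f y| <= C) -> fine (defect f) <= C.
Proof.
move=> fC; have fQ : quasimorphism f.
  by apply: le_lt_trans (defect_le fC) _; rewrite ltry.
by rewrite -lee_fin fineK ?defect_fin_num //; apply: defect_le.
Qed.

Lemma quasimorphismP f :
  quasimorphism f <-> exists C, forall x y, `|f (x * y)%g - f x - f y| <= C.
Proof.
split=> [fQ|[C fC]].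
  by exists (fine (defect f)) => x y; apply: le_fine_defect.
by apply: le_lt_trans (defect_le fC) _; rewrite ltry.
Qed.

Lemma hqm_submod_closed : submod_closed hqm.
Proof.
split=> [|a f h /asboolP[/quasimorphismP[C fC] fH]].
  apply/asboolP; split; last by move=> l x y _ _; rewrite addr0.
  by apply/quasimorphismP; exists 0 => x y; rewrite !subrr normr0.
move=> /asboolP[/quasimorphismP[D hD] hH]; apply/asboolP; split; last first.
  move=> l x y lx ly; rewrite !fctE (fH l) // (hH l) // scalerDr.
  by rewrite addrACA.
apply/quasimorphismP; exists (`|a| * C + D) => x y; rewrite !fctE.
have -> : a *: f (x * y)%g + h (x * y)%g - (a *: f x + h x)
    - (a *: f y + h y) =
  a * (f (x * y)%g - f x - f y) + (h (x * y)%g - h x - h y).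
  by rewrite /GRing.scale /=; ring.
rewrite (le_trans (ler_normD _ _)) // lerD // normrM.
by rewrite ler_wpM2l.
Qed.
HB.instance Definition _ := GRing.isSubmodClosed.Build R (L -> R) hqm
  hqm_submod_closed.

Definition H1 : {pred submodule hqm} := fun phi => `[< homomorphism (val phi) >].

Lemma H1_submod_closed : submod_closed H1.
Proof.
split=> [|a phi psi /asboolP phiH /asboolP psiH]; apply/asboolP => x y.
  by rewrite /= addr0.
by rewrite /= !fctE phiH psiH scalerDr addrACA.
Qed.
HB.instance Definition _ := GRing.isSubmodClosed.Build R _ H1
  H1_submod_closed.

Lemma generatedX x n : generated [set x] (x ^+ n)%g.
Proof.
move=> A /= [Agp xA]; have {}xA : x \in [pred x | x \in A].
  by apply/mem_set; apply: xA.
suff : (x ^+ n)%g \in [pred x | x \in A] by move/set_mem.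
elim: n => [|n IH]; first by case: Agp.
by rewrite expgS; apply: group_closedM.
Qed.

Lemma homogeneousX f x n : homogeneous f -> f (x ^+ n)%g = n%:R * f x.
Proof.
move=> fH; have fM := fH x.
have gX k : (x ^+ k)%g \in generated [set x] by apply/mem_set; apply: generatedX.
elim: n => [|n IH].
  have := fM _ _ (gX 0%N) (gX 0%N).
  by rewrite expg0 mulg1 mul0r; lra.
by rewrite expgSr fM ?gX ?(gX 1%N) // IH -natr1; ring.
Qed.

Lemma hqm_conj f g x : quasimorphism f -> homogeneous f ->
  f (g * x * g^-1)%g = f x.
Proof.
move=> /quasimorphismP[C fC] fH; apply/eqP; rewrite -subr_eq0 -normr_eq0.
set d := `|_|; apply: contraT => d_neq0.
have d_gt0 : 0 < d by rewrite lt_def d_neq0 normr_ge0.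
pose M := C + C + `|f g + f g^-1%g|.
have dM n : n%:R * d <= M.
  have -> : n%:R * d = `|f (g * x ^+ n * g^-1)%g - f (x ^+ n)%g|.
    have <- : ((g * x * g^-1) ^+ n = g * x ^+ n * g^-1)%g.
      elim: n => [|n IH]; first by rewrite !expg0 mulg1 mulgV.
      by rewrite !expgS IH !mulgA mulgVK.
    by rewrite !homogeneousX // -mulrBr normrM normr_nat.
  have -> : f (g * x ^+ n * g^-1)%g - f (x ^+ n)%g =
      (f (g * x ^+ n * g^-1)%g - f (g * x ^+ n)%g - f g^-1%g) +
      (f (g * x ^+ n)%g - f g - f (x ^+ n)%g) + (f g + f g^-1%g) by ring.
  rewrite (le_trans (ler_normD _ _)) // lerD //.
  by rewrite (le_trans (ler_normD _ _)) // lerD.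
have M_ge0 : 0 <= M by have := dM 0%N; rewrite mul0r.
have := archi_boundP (divr_ge0 M_ge0 (ltW d_gt0)).
by rewrite ltr_pdivrMr // ltNge dM.
Qed.

End Quasimorphisms.

Section Invariant.
Variables (R : realType) (G : groupType) (N : groupClosed G).
Local Notation N' := (subgroup_type N).

(* Stated relationally so that normality of [N] is not needed to form the
   conjugate [y] of [x] as an element of [N]. *)
Definition invariant (f : N' -> R) :=
  forall (g : G) (x y : N'), val y = (g * val x * g^-1)%g -> f y = f x.

(* Q(N)^G is [submodule invariant_hqm]. *)
Definition invariant_hqm : {pred N' -> R} :=
  fun f => (f \in @hqm R N') && `[< invariant f >].

Lemma invariant_hqm_submod_closed : submod_closed invariant_hqm.
Proof.
split=> [|a f h /andP[fQ /asboolP fI] /andP[hQ /asboolP hI]].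
  by apply/andP; split; [exact: rpred0 | exact/asboolP].
apply/andP; split; first by apply: rpredD => //; apply: rpredZ.
apply/asboolP => g x y yx; rewrite !fctE.
by rewrite (fI _ _ _ yx) (hI _ _ _ yx).
Qed.
HB.instance Definition _ := GRing.isSubmodClosed.Build R (N' -> R)
  invariant_hqm invariant_hqm_submod_closed.

Lemma generated_subgroup (l x : N') :
  generated [set l] x -> generated [set val l] (val x).
Proof.
move=> lx A [Agp lA]; apply: (lx [set y : N' | A (val y)]); split; last first.
  by move=> _ ->; apply: lA.
case: Agp => A1 AV; split; first by apply/mem_set/set_mem.
move=> y z /set_mem Ay /set_mem Az; apply/mem_set.
by apply/set_mem; apply: AV; apply/mem_set.
Qed.

Lemma restrict_subproof (phi : submodule (@hqm R G)) :
  (fun x : N' => val phi (val x)) \in invariant_hqm.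
Proof.
have /asboolP[phiQ phiH] := valP phi.
apply/andP; split; last first.
  by apply/asboolP => g x y /= ->; apply: hqm_conj.
apply/asboolP; split.
  have /quasimorphismP[C phiC] := phiQ.
  by apply/quasimorphismP; exists C => x y; apply: phiC.
move=> l x y /set_mem lx /set_mem ly.
by apply: (phiH (val l)); apply/mem_set; apply: generated_subgroup.
Qed.

Definition restrict (phi : submodule (@hqm R G)) : submodule invariant_hqm :=
  Submodule (restrict_subproof phi).

Definition H1inv : {pred submodule invariant_hqm} :=
  fun f => `[< homomorphism (val f) >].

Lemma H1inv_submod_closed : submod_closed H1inv.
Proof.
split=> [|a f h /asboolP fH /asboolP hH]; apply/asboolP => x y.
  by rewrite /= addr0.
by rewrite /= !fctE fH hH scalerDr addrACA.
Qed.
HB.instance Definition _ := GRing.isSubmodClosed.Build R _ H1inv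
  H1inv_submod_closed.

(* H^1(N)^G + i^* Q(G) *)
Definition H1inv_plus_res : {pred submodule invariant_hqm} :=
  fun f => `[< exists h phi, h \in H1inv /\ f = h + restrict phi >].

Lemma H1inv_plus_res_submod_closed : submod_closed H1inv_plus_res.
Proof.
split=> [|a f1 f2].
  apply/asboolP; exists 0, 0; split; first exact: rpred0.
  by apply/val_inj/funext => x; rewrite /= !fctE addr0.
move=> /asboolP[h1 [phi1 [h1H ->]]] /asboolP[h2 [phi2 [h2H ->]]].
apply/asboolP; exists (a *: h1 + h2), (a *: phi1 + phi2); split.
  by apply: rpredD => //; apply: rpredZ.
by apply/val_inj/funext => x; rewrite /= !fctE scalerDr addrACA.
Qed.
HB.instance Definition _ := GRing.isSubmodClosed.Build R _ H1inv_plus_res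
  H1inv_plus_res_submod_closed.

Definition W : lmodType R := quotient H1inv_plus_res.

Definition Qinv_H1inv : Type := quotient H1inv.
HB.instance Definition _ := GRing.Lmodule.on Qinv_H1inv.
HB.instance Definition _ := Quotient.on Qinv_H1inv.

(* Independent of the representative, see [defect_norm_pi]. *)
Definition defect_norm (q : Qinv_H1inv) : R := fine (defect (val (repr q))).

Lemma invariant_hqm_quasimorphism (f : submodule invariant_hqm) :
  quasimorphism (val f).
Proof. by have /andP[/asboolP[]] := valP f. Qed.

Lemma pi_H1inv_eqP (f h : submodule invariant_hqm) :
  \pi_Qinv_H1inv f = \pi_Qinv_H1inv h <-> homomorphism (val (f - h)).
Proof.
split=> [/(@quot_eqP _ _ H1inv)/asboolP //|fh].
by apply/(@quot_eqP _ _ H1inv)/asboolP.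
Qed.

Lemma defect_norm_pi (f : submodule invariant_hqm) :
  defect_norm (\pi_Qinv_H1inv f) = fine (defect (val f)).
Proof.
rewrite /defect_norm; set h := repr _.
have /pi_H1inv_eqP hf : \pi_Qinv_H1inv h = \pi_Qinv_H1inv f by rewrite reprK.
congr (fine (ereal_sup _)); apply/funext => r; apply/propext.
suff E x y : val h (x * y)%g - val h x - val h y =
    val f (x * y)%g - val f x - val f y.
  by split=> -[x _ [y _ <-]]; exists x => //; exists y => //; rewrite E.
by have := hf x y; rewrite /= !fctE; lra.
Qed.

Lemma defect_normD p q : defect_norm (p + q) <= defect_norm p + defect_norm q.
Proof.
rewrite -[p]reprK -[q]reprK -(@pi_quotientD _ _ H1inv) !defect_norm_pi.
move: (repr p) (repr q) => f h.
apply: fine_defect_le => x y; rewrite /= !fctE.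
have -> : val f (x * y)%g + val h (x * y)%g - (val f x + val h x)
    - (val f y + val h y) = (val f (x * y)%g - val f x - val f y)
    + (val h (x * y)%g - val h x - val h y) by ring.
rewrite (le_trans (ler_normD _ _)) // lerD //; apply: le_fine_defect;
  exact: invariant_hqm_quasimorphism.
Qed.

Lemma defect_norm_leZ a q : defect_norm (a *: q) <= `|a| * defect_norm q.
Proof.
rewrite -[q]reprK -(@pi_quotientZ _ _ H1inv) !defect_norm_pi.
move: (repr q) => f.
apply: fine_defect_le => x y; rewrite /= !fctE /GRing.scale /= -!mulrBr normrM.
by rewrite ler_wpM2l // le_fine_defect //; apply: invariant_hqm_quasimorphism.
Qed.

Lemma defect_norm_ge0 q : 0 <= defect_norm q.
Proof. by rewrite fine_ge0 // defect_ge0. Qed.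

Lemma defect_normZ a q : defect_norm (a *: q) = `|a| * defect_norm q.
Proof.
have [->|a0] := eqVneq a 0.
  apply/eqP; rewrite eq_le defect_norm_leZ /= normr0 mul0r.
  exact: defect_norm_ge0.
apply/eqP; rewrite eq_le defect_norm_leZ /=.
rewrite mulrC -ler_pdivlMr ?normr_gt0 // mulrC -normfV.
by rewrite -[q in leLHS](scalerK a0) defect_norm_leZ.
Qed.

Lemma defect_norm_eq0 q : defect_norm q = 0 -> q = 0.
Proof.
rewrite -[q]reprK defect_norm_pi => f0.
rewrite -(@pi_quotient0 _ _ H1inv).
apply/(@quot_eqP _ _ H1inv); rewrite subr0; apply/asboolP => x y.
have := le_fine_defect x y (invariant_hqm_quasimorphism (repr q)).
rewrite f0 normr_le0 => /eqP; lra.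
Qed.

HB.instance Definition _ := Lmodule_isNormed.Build R Qinv_H1inv
  defect_normD defect_normZ defect_norm_eq0.

Definition Q_H1 : Type := quotient (@H1 R G).
HB.instance Definition _ := GRing.Lmodule.on Q_H1.
HB.instance Definition _ := Quotient.on Q_H1.

(* Independent of the representative, see [res_hat_pi]. *)
Definition res_hat (q : Q_H1) : Qinv_H1inv :=
  \pi_Qinv_H1inv (restrict (repr q)).

Lemma res_hat_pi (phi : submodule (@hqm R G)) :
  res_hat (\pi_Q_H1 phi) = \pi_Qinv_H1inv (restrict phi).
Proof.
apply/pi_H1inv_eqP => x y; set psi := repr _.
have : \pi_Q_H1 psi = \pi_Q_H1 phi by rewrite reprK.
by move/(@quot_eqP _ _ (@H1 R G))/asboolP => /(_ (val x) (val y)).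
Qed.

End Invariant.

(* Main.v *)
(* If no such sequence exists, then
   [scl_{G,N}(y) <= M (scl_G(y) + scl_{H,K}(phi y))] on [[G,N]] for some [M].
   Let [f] be in [Q(N)^G].  On the group of pairs of sequences
   [(x_k)] in [G], [(z_k)] in [K], the quantity
   [limsup (cl_G(x_k) + cl_{H,K}(z_k)) / k] is subadditive and vanishes on
   commutators, and up to a constant it dominates the additive functional
   [(x_k, phi x_k) |-> lim f(x_k)/k].  A Hahn-Banach extension of this
   functional, evaluated at sequences of powers [((g^k), 1)] and [(1, (h^k))],
   yields [psi] in [Q(G)] and [mu] in [Q(K)^H] with [f = psi + mu o phi] on
   [[G,N]], hence modulo [H^1(N)^G].  So [phi^*] maps [W(H,K)] onto [W(G,N)],
   against the assumption on dimensions. *)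

From HB Require Import structures.
Require Import Defs.
From mathcomp Require Import all_boot all_order all_algebra.
From mathcomp Require Import all_classical all_reals ereal topology.
From mathcomp Require Import normedtype sequences ring lra.

Set Implicit Arguments.
Unset Strict Implicit.
Unset Printing Implicit Defensive.

Import Order.TTheory GRing.Theory Num.Theory.
Import numFieldNormedType.Exports.

Local Open Scope classical_set_scope.
Local Open Scope ring_scope.

(** * Dimensions *)

Definition linearly_independent (R : realType) (V : lmodType R) n
    (v : 'I_n -> V) :=
  forall c : 'I_n -> R, \sum_i c i *: v i = 0 -> forall i, c i = 0.

Definition spanning (R : realType) (V : lmodType R) n (v : 'I_n -> V) :=
  forall x, exists c : 'I_n -> R, x = \sum_i c i *: v i.

(** The coefficients of the [v i] in terms of the [w j] form an [m] by [n] matrix. If [n < m], its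
    left kernel is nonzero, and a nonzero row of the kernel is a linear relation among the [v i]. *)
Lemma independent_le_spanning (R : realType) (V : lmodType R) m n
    (v : 'I_m -> V) (w : 'I_n -> V) :
  linearly_independent v -> spanning w -> (m <= n)%N.
Proof.
move=> vI wS; have /choice[A vA] : forall i, exists a, v i = \sum_j a j *: w j.
  by move=> i; apply: wS.
rewrite leqNgt; apply/negP => ltnm.
pose B := (\matrix_(i < m, j < n) A i j)%R.
have /matrix0Pn[i0 [i1 Kn0]] : kermx B != 0.
  rewrite -mxrank_eq0 mxrank_ker subn_eq0 -ltnNge.
  exact: leq_ltn_trans (rank_leq_col B) ltnm.
move/eqP: Kn0; apply; apply: vI i1.
have : row i0 (kermx B) *m B = 0 by rewrite -row_mul mulmx_ker row0.
move: (kermx B) => C CB.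
under eq_bigr do rewrite vA scaler_sumr.
rewrite exchange_big /=; apply: big1 => j _.
under eq_bigr do rewrite scalerA.
rewrite -scaler_suml -[RHS](scale0r (w j)); congr (_ *: _).
transitivity ((row i0 C *m B) 0 j); last by rewrite CB mxE.
by rewrite mxE; apply: eq_bigr => i _; rewrite !mxE.
Qed.

Lemma spanning_basis (R : realType) (V : lmodType R) n (w : 'I_n -> V) :
  spanning w -> exists2 m, (m <= n)%N & exists v : 'I_m -> V, is_basis v.
Proof.
elim: n => [|n IH] in w *.
  move=> wS; exists 0%N => //; exists w; split=> // c _; by case.
move=> wS; have [wI|] := pselect (linearly_independent w).
  by exists n.+1 => //; exists w.
move=> /existsNP[c /not_implyP[c0 /existsNP[j /eqP cj]]].
have [|m mn mv] := IH (fun i => w (lift j i)); last first.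
  by exists m => //; apply: leqW.
move=> x; have [d ->] := wS x.
exists (fun i => d (lift j i) - d j / c j * c (lift j i)).
have wj : w j = \sum_i (- (c j)^-1 * c (lift j i)) *: w (lift j i).
  under eq_bigr do rewrite -scalerA.
  rewrite -scaler_sumr; apply: (scalerI cj).
  rewrite scalerA mulrN divff // scaleN1r.
  by apply/eqP; rewrite -addr_eq0 -[eqbRHS]c0 (bigD1_ord j).
rewrite (bigD1_ord j) //= {1}wj scaler_sumr -big_split /=.
by apply: eq_bigr => i _; rewrite scalerA -scalerDl; congr (_ *: _); ring.
Qed.

Lemma dimension_basis (R : realType) (V : lmodType R) n (v : 'I_n -> V) :
  is_basis v -> dimension V = (n%:R)%:E.
Proof.
move=> [vI vS]; apply: xget_unique; first by exists n => //; exists v.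
move=> _ [m [w [wI wS]] <-]; congr (_%:R%:E).
by apply/eqP; rewrite eqn_leq (independent_le_spanning wI vS)
  (independent_le_spanning vI wS).
Qed.

(** * Dominated extension *)

Lemma pair_mulrz (U V : zmodType) (u : U) (v : V) (n : int) :
  (u, v) *~ n = (u *~ n, v *~ n).
Proof. by rewrite [LHS]surjective_pairing !raddfMz. Qed.

(* [P x c] reads [p x <= c] for a seminorm [p], with [p x] infinite when there
   is no such [c]. *)
Section HahnBanach.
Variables (R : realType) (M : zmodType) (P : M -> R -> Prop).
Hypothesis P0 : P 0 0.
Hypothesis PD : forall x y c d, P x c -> P y d -> P (x + y) (c + d).
Hypothesis PN : forall x c, P x c -> P (- x) c.

(* Graphs of homomorphisms on subgroups of [M], dominated by [P]. *)
Record admissible (T : set (M * R)) : Prop := Admissible {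
  admissible0 : T 0;
  admissibleB : forall u v, T u -> T v -> T (u - v);
  admissible_le : forall x c d, T (x, c) -> P x d -> c <= d }.

Lemma admissibleN T u : admissible T -> T u -> T (- u).
Proof. by move=> [T0 TB _] Tu; rewrite -[- u]add0r; apply: TB. Qed.

Lemma admissibleD T u v : admissible T -> T u -> T v -> T (u + v).
Proof.
move=> aT Tu Tv; rewrite -[v]opprK; apply: admissibleB => //.
exact: admissibleN.
Qed.

Lemma admissibleMn T u n : admissible T -> T u -> T (u *+ n).
Proof.
move=> aT Tu; elim: n => [|n IH]; first exact: admissible0 aT.
by rewrite mulrS; apply: admissibleD.
Qed.

(** The value [a] at [x] has to satisfy [- d <= c + n a <= d] whenever [T (t, c)], [P (t + n x) d]
    and [n > 0]. Every lower bound that this imposes on [a] is at most every upper bound, so the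
    supremum of the lower bounds is a valid choice. *)
Lemma extend_graph T (x : M) : admissible T ->
  exists a, admissible [set u | exists n : int, T (u - (x, a) *~ n)].
Proof.
move=> aT; have PMn y c n : (0 < n)%N -> P y c -> P (y *+ n) (c *+ n).
  case: n => // n _ Py; elim: n => [|n IH]; first by rewrite !mulr1n.
  by rewrite mulrS [in X in P _ X]mulrS; apply: PD.
pose q (n : nat) (t : M) (c d : R) :=
  [/\ (0 < n)%N, T (t, c) & P (t + x *+ n) d].
(* The combination [n' (t + n x) - n (t' + n' x)] no longer involves [x], so the domination of [T]
   by [P] applies to it. *)
have q_le n t c d n' t' c' d' : q n t c d -> q n' t' c' d' ->
    (- d' - c') / n'%:R <= (d - c) / n%:R.
  move=> [n0 Tt Pt] [n'0 Tt' Pt'].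
  have := admissibleB aT (admissibleMn n' aT Tt) (admissibleMn n aT Tt').
  have := PD (PMn _ _ _ n'0 Pt) (PN (PMn _ _ _ n0 Pt')).
  have -> : (t + x *+ n) *+ n' - (t' + x *+ n') *+ n = t *+ n' - t' *+ n.
    by rewrite !mulrnDl opprD -!mulrnA mulnC addrACA subrr addr0.
  have pMn (u : M * R) k : u *+ k = (u.1 *+ k, u.2 *+ k).
    by rewrite [LHS]surjective_pairing !raddfMn.
  move=> Pd; rewrite !pMn => Tc; have cd := admissible_le aT Tc Pd.
  rewrite ler_pdivrMr ?ltr0n // mulrAC ler_pdivlMr ?ltr0n //.
  by rewrite !mulr_natr !mulrnBl mulNrn; move: cd => /=; lra.
(* If [L] is empty, [x] is unconstrained and the default value of [sup] is as good as any other. *)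
pose L := [set r | exists n t c d, q n t c d /\ r = (- d - c) / n%:R].
pose a := sup L; exists a.
have aP n t c d : q n t c d -> - d <= c + a *+ n <= d.
  move=> qn; have n0 : (0 < n%:R :> R) by case: qn; rewrite ltr0n.
  have Lr : L ((- d - c) / n%:R) by exists n, t, c, d.
  have Lub : ubound L ((d - c) / n%:R).
    by move=> _ [n' [t' [c' [d' [qn' ->]]]]]; exact: q_le qn qn'.
  have : (- d - c) / n%:R <= a by apply: ub_le_sup => //; eexists; exact: Lub.
  have : a <= (d - c) / n%:R by apply: ge_sup => //; exists ((- d - c) / n%:R).
  rewrite ler_pdivlMr // ler_pdivrMr // -[a *+ n]mulr_natr; lra.
split.
- by exists 0; rewrite mulr0z subr0; apply: admissible0 aT.
- move=> u v [n Tu] [m Tv]; exists (n - m).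
  have -> : u - v - (x, a) *~ (n - m) = u - (x, a) *~ n - (v - (x, a) *~ m).
    by rewrite mulrzBr !opprB addrACA [RHS]addrACA [in RHS](addrC _ (- v)).
  exact: admissibleB.
move=> y c d [n]; rewrite pair_mulrz => Tw Py.
have {}Tw : T (y - x *~ n, c - a *~ n) by [].
case: n Tw => [[|n]|n] Tw.
- by apply: (admissible_le aT) Py; move: Tw; rewrite !mulr0z !subr0.
- have /aP/andP[_] : q n.+1 (y - x *~ n.+1) (c - a *+ n.+1) d.
    by split=> //; rewrite subrK.
  by rewrite subrK.
(* A negative multiple of [x] is treated through the opposite element, using the lower bound in
   [aP]. *)
have /aP/andP[+ _] : q n.+1 (- (y - x *~ Negz n)) (- (c - a *~ Negz n)) d.
  split=> //; first exact: admissibleN Tw.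
  by rewrite NegzE opprB mulrNz addrAC addNr add0r; apply: PN.
by rewrite NegzE mulrNz opprB addrAC addNr add0r lerN2.
Qed.

Lemma hahn_banach_zmod T0 : admissible T0 ->
  exists F : M -> R, [/\ forall x y, F (x + y) = F x + F y,
    forall x c, T0 (x, c) -> F x = c & forall x c, P x c -> F x <= c].
Proof.
(* The empty set is allowed in [S] because [Zorn_bigcup] also asks for the union of the empty chain.
   A maximal element is not empty, since [T0] is admissible and contains 0. *)
move=> aT0; pose S (A : set (M * R)) := A = set0 \/ (admissible A /\ T0 `<=` A).
have [F FS Ftot|T [TS Tmax]] := @Zorn_bigcup (M * R)%type S.
  have [[A [FA A0]]|F0] := pselect (exists A, F A /\ A <> set0); last first.
    left; apply/seteqP; split => // u [A FA Au]; exfalso; apply: F0.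
    by exists A; split=> // A0; rewrite A0 in Au.
  have [//|[aA T0A]] := FS _ FA.
  right; split; last by apply: subset_trans T0A _; apply: bigcup_sup.
  have FSa B u : F B -> B u -> admissible B.
    by move=> FB Bu; have [B0|[]//] := FS _ FB; rewrite B0 in Bu.
  split; first by exists A => //; apply: admissible0 aA.
  - move=> u v [B FB Bu] [C FC Cv]; have [BC|CB] := Ftot _ _ FB FC.
      by exists C => //; apply: (admissibleB (FSa _ _ FC Cv)) => //; apply: BC.
    by exists B => //; apply: (admissibleB (FSa _ _ FB Bu)) => //; apply: CB.
  by move=> x c d [B FB Bx]; apply: (admissible_le (FSa _ _ FB Bx)).
have [aT T0T] : admissible T /\ T0 `<=` T.
  case: TS => // T_0; exfalso; apply: (Tmax T0); last by right; split.
  by rewrite T_0; split; [exact: sub0set | move=> /(_ 0 (admissible0 aT0))].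
have Tx x : exists c, T (x, c).
  have [a aT'] := extend_graph x aT; exists a.
  apply: contrapT => Txa; apply: (Tmax _ _ (or_intror (conj aT' _))).
    split; last first.
      move=> sub; apply/Txa/sub; exists 1.
      by rewrite mulr1z subrr; apply: admissible0 aT.
    by move=> u Tu; exists 0; rewrite mulr0z subr0.
  by move=> u T0u; exists 0; rewrite mulr0z subr0; apply: T0T.
have /choice[F TF] := Tx.
(* The difference of two values at [x] is a value at 0, which [P 0 0] bounds by 0. Hence [T] is
   single-valued. *)
have T_le x c d : T (x, c) -> T (x, d) -> c <= d.
  move=> Tc Td; have := admissibleB aT Tc Td.
  by rewrite -subr_le0 => /admissible_le; apply => //; rewrite /= subrr.
have T_eq x c : T (x, c) -> F x = c.
  by move=> Tc; apply/eqP; rewrite eq_le !(T_le x).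
exists F; split.
- by move=> x y; apply: T_eq; apply: (admissibleD aT (TF x) (TF y)).
- by move=> x c /T0T; apply: T_eq.
- by move=> x c; apply: admissible_le aT _ _ _ (TF x).
Qed.

End HahnBanach.

(** * Dominated extension on noncommutative groups *)

Section HahnBanachGroup.
Variables (R : realType) (G : groupType) (P : G -> R -> Prop).

Record commutator_null_seminorm : Prop := CommutatorNullSeminorm {
  seminormM : forall x y c d, P x c -> P y d -> P (x * y)%g (c + d);
  seminormV : forall x c, P x c -> P x^-1%g c;
  seminormR : forall x y, P [~ x, y]%g 0 }.

Hypothesis P_seminorm : commutator_null_seminorm.

Let PM x y c d := @seminormM P_seminorm x y c d.
Let PV x c := @seminormV P_seminorm x c.
Let PR x y := seminormR P_seminorm x y.

Definition null_eq : rel G := fun x y => `[< P (x^-1 * y)%g 0 >].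

Lemma seminorm1 : P 1%g 0. Proof. by have := PR 1%g 1%g; rewrite commg1. Qed.

(** [x ^ y] is the product of [x] and a commutator, and commutators are null. Invariance under
    conjugation is what makes [null_eq] compatible with products and inverses. *)
Lemma seminormJ x y : P x 0 -> P (x ^ y)%g 0.
Proof.
move=> Px; rewrite -[(x ^ y)%g](mulVKg x) -commgEl -[0]addr0.
exact: PM.
Qed.

Lemma null_eqM x x' y y' :
  null_eq x x' -> null_eq y y' -> null_eq (x * y)%g (x' * y')%g.
Proof.
move=> /asboolP xx' /asboolP yy'; apply/asboolP.
have -> : ((x * y)^-1 * (x' * y') = (x^-1 * x') ^ y * (y^-1 * y'))%g.
  by rewrite conjgE invgM !mulgA mulgK.
by rewrite -[0]addr0; apply: PM => //; apply: seminormJ.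
Qed.

Lemma null_eqV x y : null_eq x y -> null_eq x^-1%g y^-1%g.
Proof.
move=> /asboolP xy; apply/asboolP; rewrite invgK.
have -> : (x * y^-1 = ((x^-1 * y) ^ x^-1)^-1)%g.
  by rewrite conjgE invgK -!mulgA mulVKg invgM invgK.
exact/PV/seminormJ.
Qed.

Lemma seminorm_null_eq x y c : null_eq x y -> P x c -> P y c.
Proof.
by move=> /asboolP xy Px; rewrite -[y](mulVKg x) -[c]addr0; apply: PM.
Qed.

Lemma null_eq_refl : reflexive null_eq.
Proof. by move=> x; apply/asboolP; rewrite mulVg; apply: seminorm1. Qed.

Lemma null_eq_sym : symmetric null_eq.
Proof.
suff S x y : null_eq x y -> null_eq y x by move=> x y; apply/idP/idP; apply: S.
by move=> /asboolP/PV; rewrite invgM invgK => xy; apply/asboolP.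
Qed.

Lemma null_eq_trans : transitive null_eq.
Proof.
move=> y x z /asboolP xy /asboolP yz; apply/asboolP.
have -> : (x^-1 * z = x^-1 * y * (y^-1 * z))%g by rewrite mulgA mulgK.
by rewrite -[0]addr0; apply: PM.
Qed.

(* The quotient by the null elements is abelian, because [P] is null on
   commutators. *)
Canonical null_equiv :=
  EquivRel null_eq null_eq_refl null_eq_sym null_eq_trans.

Local Open Scope quotient_scope.

Definition null_quotient := {eq_quot null_equiv}.
HB.instance Definition _ := Choice.on null_quotient.
HB.instance Definition _ := EqQuotient.on null_quotient.

Let pi (x : G) : null_quotient := \pi_null_quotient x.

Lemma null_piP x y : reflect (pi x = pi y) (null_eq x y).
Proof. by apply: (iffP idP) => [xy|/eqmodP//]; apply/eqmodP. Qed.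

Definition null_add (u v : null_quotient) := pi (repr u * repr v)%g.
Definition null_opp (u : null_quotient) := pi (repr u)^-1%g.

Lemma null_repr x : null_eq (repr (pi x)) x.
Proof. by apply/null_piP; rewrite /pi reprK. Qed.

Lemma null_piM x y : pi (x * y)%g = null_add (pi x) (pi y).
Proof. by apply/esym/null_piP/null_eqM; apply: null_repr. Qed.

Lemma null_piV x : pi x^-1%g = null_opp (pi x).
Proof. by apply/esym/null_piP/null_eqV; apply: null_repr. Qed.

Lemma null_pi_surj u : exists x, u = pi x.
Proof. by exists (repr u); rewrite /pi reprK. Qed.

Lemma null_addA : associative null_add.
Proof.
move=> u v w; have [x ->] := null_pi_surj u; have [y ->] := null_pi_surj v.
by have [z ->] := null_pi_surj w; rewrite -!null_piM mulgA.
Qed.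

Lemma null_addC : commutative null_add.
Proof.
move=> u v; have [x ->] := null_pi_surj u; have [y ->] := null_pi_surj v.
rewrite -!null_piM; apply/null_piP/asboolP.
by have := PR y x; rewrite /commg conjgE invgM !mulgA.
Qed.

Lemma null_add0 : left_id (pi 1%g) null_add.
Proof. by move=> u; have [x ->] := null_pi_surj u; rewrite -null_piM mul1g. Qed.

Lemma null_addN : left_inverse (pi 1%g) null_opp null_add.
Proof.
by move=> u; have [x ->] := null_pi_surj u; rewrite -null_piV -null_piM mulVg.
Qed.

HB.instance Definition _ := GRing.isZmodule.Build null_quotient
  null_addA null_addC null_add0 null_addN.

(** Both [T] and [P] are pushed to the abelian quotient by null elements. Domination survives there
    because [P] is stable under [null_eq], and the extension is pulled back along the projection. *)
Lemma hahn_banach_group (T : G -> R -> Prop) :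
  T 1%g 0 ->
  (forall x y c d, T x c -> T y d -> T (x / y)%g (c - d)) ->
  (forall x c d, T x c -> P x d -> c <= d) ->
  exists F : G -> R, [/\ homomorphism F, forall x c, T x c -> F x = c &
    forall x c, P x c -> F x <= c].
Proof.
move=> T1 TF T_le.
pose Pq (u : null_quotient) (c : R) := exists2 x, u = pi x & P x c.
pose Tq := [set w : null_quotient * R | exists2 x, w.1 = pi x & T x w.2].
have [||||F [FD FT FP]] := @hahn_banach_zmod R null_quotient Pq _ _ _ Tq.
- by exists 1%g => //; apply: seminorm1.
- move=> _ _ c d [x -> Px] [y -> Py]; exists (x * y)%g; last exact: PM.
  by rewrite null_piM.
- by move=> _ c [x -> Px]; exists x^-1%g; [rewrite null_piV|apply: PV].
- split.
  + by exists 1%g.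
  + move=> [_ c] [_ d] [x /= -> Tx] [y /= -> Ty]; exists (x / y)%g => /=.
      by rewrite null_piM null_piV.
    exact: TF.
  move=> u c d [x /= -> Tx] [y /null_piP xy Py].
  by apply: T_le Tx _; apply: seminorm_null_eq Py; rewrite null_eq_sym.
exists (F \o pi); split.
- by move=> x y; rewrite /= null_piM FD.
- by move=> x c Tx; apply: FT; exists x.
- by move=> x c Px; apply: FP; exists x.
Qed.

End HahnBanachGroup.

(** * Stable lengths *)

(** The limit is the infimum of [u k / k] over [k > 0]. Given [m] with [u m / m] close to the
    infimum, Euclidean division of [k] by [m] bounds [u k] by [k (u m / m)] up to a constant. *)
Lemma fekete (R : realType) (u : nat -> R) :
  (forall n, 0 <= u n) -> (forall m n, u (m + n)%N <= u m + u n) ->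
  cvg (u k / k%:R @[k --> \oo]).
Proof.
move=> u0 uD; pose E := [set u k / k%:R | k in [set k | (0 < k)%N]].
have E_lb : lbound E 0 by move=> _ [k _ <-]; rewrite divr_ge0.
have E_inf : has_inf E.
  by split; [exists (u 1%N / 1%:R); exists 1%N | exists 0].
suff : u k / k%:R @[k --> \oo] --> inf E by move=> /cvgP.
apply/cvgrPdist_le => e e0.
have e2 : 0 < e / 2 by rewrite divr_gt0.
have [_ [m /= m0 <-] um] := inf_adherent e2 E_inf.
have uM q : u (q * m)%N <= q%:R * u m + u 0%N.
  elim: q => [|q IH]; first by rewrite mul0r add0r.
  rewrite mulSn -natr1 (le_trans (uD _ _)) //; lra.
(* [C] bounds the contribution of every remainder modulo [m], together with [u 0], which is not
   assumed to vanish. *)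
pose C := u 0%N + \sum_(r < m) u r.
have C0 : 0 <= C by rewrite addr_ge0 // sumr_ge0.
near=> k.
have k0 : (0 < k)%N by near: k; apply: nbhs_infty_gt.
have k0R : 0 < k%:R :> R by rewrite ltr0n.
have infE : inf E <= u k / k%:R by apply: ge_inf; [exists 0 | exists k].
rewrite distrC ger0_norm ?subr_ge0 // lerBlDr.
suff ukC : u k <= k%:R * (u m / m%:R) + C.
  have CE : C <= k%:R * (e / 2).
    rewrite -ler_pdivrMr ?divr_gt0 //.
    by near: k; apply: nbhs_infty_ger.
  rewrite ler_pdivrMr // (le_trans ukC) // [leRHS]mulrC.
  have : k%:R * (u m / m%:R) <= k%:R * (inf E + e / 2).
    by rewrite ler_pM2l // ltW.
  by rewrite !mulrDr; lra.
rewrite [X in u X](divn_eq k m) (le_trans (uD _ _)) // /C addrA lerD //.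
  rewrite (le_trans (uM _)) // lerD2r [leLHS]mulrC mulrCA.
  rewrite ler_wpM2l // ler_pdivlMr ?ltr0n //.
  by rewrite -natrM ler_nat leq_trunc_div.
rewrite (bigD1 (Ordinal (ltn_pmod k m0))) //= lerDl.
by apply: sumr_ge0 => i _.
Unshelve. all: by end_near.
Qed.

Section WordLength.
Variables (G : groupType) (S : set G).
Implicit Types (x y : G) (m n : nat).

Lemma products0 : products S 0 1%g.
Proof. by exists [tuple]; rewrite big_nil. Qed.

Lemma productsM m n x y :
  products S m x -> products S n y -> products S (m + n) (x * y)%g.
Proof.
move=> [s [sS ->]] [t [tS ->]]; exists [tuple of s ++ t]; split.
  by move=> a; rewrite mem_cat => /orP[/sS|/tS].
by rewrite big_cat.
Qed.

Lemma products1 x : S x \/ S x^-1%g -> products S 1 x.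
Proof.
move=> Sx; exists [tuple x]; rewrite big_seq1; split=> // a.
by rewrite inE => /eqP->.
Qed.

Lemma productsS n y : products S n.+1 y ->
  exists a z, [/\ S a \/ S a^-1%g, products S n z & y = (a * z)%g].
Proof.
move=> [s [sS ->]]; exists (thead s), (\prod_(a <- behead s) a)%g; split.
- by apply: sS; apply: mem_tnth.
- by exists [tuple of behead s]; split=> // a /mem_behead/sS.
- by rewrite [in LHS](tuple_eta s) big_cons.
Qed.

Lemma productsV n x : products S n x -> products S n x^-1%g.
Proof.
elim: n => [|n IH] in x *.
  by case=> s [_ ->]; rewrite tuple0 big_nil invg1; apply: products0.
move=> /productsS[a [z [Sa /IH Sz ->]]]; rewrite invgM -addn1.
apply: productsM => //; apply: products1; rewrite invgK.
by case: Sa; [right|left].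
Qed.

Lemma productsX n x k : products S n x -> products S (k * n) (x ^+ k)%g.
Proof.
move=> Sx; elim: k => [|k IH]; first exact: products0.
by rewrite mulSn expgS; apply: productsM.
Qed.

Lemma generated_products n y : products S n y -> generated S y.
Proof.
move=> Sy A [gA SA]; suff : y \in [pred x | x \in A] by move/set_mem.
elim: n => [|n IH] in y Sy *.
  by case: Sy => s [_ ->]; rewrite tuple0 big_nil; case: gA.
have [a [z [Sa /IH zA ->]]] := productsS Sy.
apply: group_closedM => //; case: Sa => [/SA/mem_set //|/SA/mem_set aA].
by rewrite -[a]invgK; apply: (group_closedV gA).
Qed.

Lemma generatedP y : generated S y <-> exists n, products S n y.
Proof.
split=> [gy|[n]]; last exact: generated_products.
apply: (gy [set y | exists n, products S n y]); split.
  split; first by apply/mem_set; exists 0%N; apply: products0.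
  move=> x z /set_mem[m Sx] /set_mem[n Sz]; apply/mem_set; exists (m + n)%N.
  by apply: productsM => //; apply: productsV.
by move=> x Sx; exists 1%N; apply: products1; left.
Qed.

Lemma generatedV y : generated S y -> generated S y^-1%g.
Proof. by move=> /generatedP[n /productsV]; apply: generated_products. Qed.

Lemma generatedM x y : generated S x -> generated S y -> generated S (x * y)%g.
Proof.
move=> /generatedP[m Sx] /generatedP[n /(productsM Sx)].
exact: generated_products.
Qed.

Lemma generated_expg x k : generated S x -> generated S (x ^+ k)%g.
Proof. by move=> /generatedP[n /(productsX k)]; apply: generated_products. Qed.

Lemma word_lengthP y : generated S y ->
  products S (word_length S y) y /\
  forall m, products S m y -> (word_length S y <= m)%N.
Proof.
move=> /generatedP[n Sy].
have exP : exists n, `[< products S n y >] by exists n; apply/asboolP.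
(* [word_length] is an [xget], so a least length has to be exhibited before its specification is
   available. *)
suff : exists m, products S m y /\ forall k, products S k y -> (m <= k)%N.
  by move=> /(xgetPex 0%N).
exists (ex_minn exP); case: ex_minnP => m /asboolP Sm m_min; split=> // k Sk.
by apply: m_min; apply/asboolP.
Qed.

Lemma word_length_products y : generated S y -> products S (word_length S y) y.
Proof. by move=> /word_lengthP[]. Qed.

Lemma word_length_le m y : products S m y -> (word_length S y <= m)%N.
Proof.
by move=> Sy; have [_] := word_lengthP (generated_products Sy); apply.
Qed.

End WordLength.

Section StableLength.
Variables (R : realType) (G : groupType) (N : {pred G}).
Implicit Types (y : G).

Lemma cvg_scl y : mixed_commutator_subgroup N y ->
  cvg (((cl N (y ^+ k)%g)%:R / k%:R : R) @[k --> \oo]).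
Proof.
move=> Ny; apply: (@fekete _ (fun k => (cl N (y ^+ k)%g)%:R)) => // m n.
rewrite -natrD ler_nat expgnDr; apply: word_length_le.
by apply: productsM; apply: word_length_products; exact: generated_expg _ Ny.
Qed.

Lemma scl_ge0 y : mixed_commutator_subgroup N y -> 0 <= scl R N y.
Proof.
move=> /cvg_scl Ny; apply: limr_ge => //.
by apply: nearW => k; rewrite divr_ge0.
Qed.

Lemma scl_le_products n y : products (mixed_commutators N) n y ->
  scl R N y <= n%:R.
Proof.
move=> Ny; apply: limr_le.
  by apply: cvg_scl; exact: generated_products Ny.
near=> k; rewrite ler_pdivrMr ?ltr0n -?natrM ?ler_nat.
  by rewrite mulnC; apply/word_length_le/productsX.
by near: k; apply: nbhs_infty_gt.
Unshelve. all: by end_near.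
Qed.

End StableLength.

(** * Quasimorphisms *)

Lemma multiplicative1 (G H : groupType) (phi : {multiplicative G -> H}) :
  phi 1%g = 1%g.
Proof. by apply: (mulgI (phi 1%g)); rewrite -gmulfM !mulg1. Qed.

Lemma multiplicativeV (G H : groupType) (phi : {multiplicative G -> H}) x :
  phi x^-1%g = (phi x)^-1%g.
Proof. by apply: (mulgI (phi x)); rewrite -gmulfM !mulgV multiplicative1. Qed.

Lemma multiplicativeX (G H : groupType) (phi : {multiplicative G -> H}) x k :
  phi (x ^+ k)%g = (phi x ^+ k)%g.
Proof.
elim: k => [|k IH]; first by rewrite !expg0 multiplicative1.
by rewrite !expgS gmulfM IH.
Qed.

Lemma natmul_bounded_eq0 (R : realType) (e M : R) :
  (forall k : nat, `|k%:R * e| <= M) -> e = 0.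
Proof.
move=> eM; apply/eqP; rewrite -normr_eq0; apply: contraT => e0.
have {}e0 : 0 < `|e| by rewrite lt_def e0 normr_ge0.
have M0 : 0 <= M by have := eM 0%N; rewrite mul0r normr0.
have := archi_boundP (divr_ge0 M0 (ltW e0)).
by rewrite ltr_pdivrMr // ltNge -[X in X * _]normr_nat -normrM eM.
Qed.

(** * Words in mixed commutators *)

Section MixedCommutators.
Variables (G : groupType) (N : {pred G}).
Hypothesis N_normal : normal_subgroup N.
Local Notation S := (mixed_commutators N).

Lemma mixed_commutatorsJ x y : S x -> S (y * x * y^-1)%g.
Proof.
move=> [g _ [a Na <-]]; exists (y * g * y^-1)%g => //.
exists (y * a * y^-1)%g; first exact: N_normal.
by rewrite !invgM !invgK !mulgA !mulgVK.
Qed.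

Lemma products_mixedJ n x y : products S n x -> products S n (y * x * y^-1)%g.
Proof.
elim: n => [|n IH] in x *.
  by case=> s [_ ->]; rewrite tuple0 big_nil mulg1 mulgV; apply: products0.
move=> /productsS[a [z [Sa /IH Sz ->]]].
have -> : (y * (a * z) * y^-1 = y * a * y^-1 * (y * z * y^-1))%g.
  by rewrite !mulgA mulgVK.
rewrite -add1n; apply: productsM Sz; apply: products1.
have [/mixed_commutatorsJ|/mixed_commutatorsJ] := Sa; first by left.
by move=> /(_ y) Sya; right; rewrite !invgM invgK mulgA.
Qed.

(** Going from [k] to [k + 1] conjugates the element by [x * y] and multiplies it by one mixed
    commutator, that of [x] and [y ^+ k.+1]. Conjugation preserves the length, so the length grows
    at most linearly in [k]. *)
Lemma products_expgM x y k : (forall i, y ^+ i \in N)%g ->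
  products S k ((x * y) ^+ k * x ^- k * y ^- k)%g.
Proof.
move=> Ny; elim: k => [|k IH].
  by rewrite !expg0 !invg1 !mulg1; apply: products0.
set w := (_ * _ * _)%g in IH.
have xyk : ((x * y) ^+ k = w * y ^+ k * x ^+ k)%g by rewrite /w !mulgVK.
have -> : ((x * y) ^+ k.+1 * x ^- k.+1 * y ^- k.+1 =
    (x * y) * w * (x * y)^-1 * (x * y ^+ k.+1 * x^-1 * (y ^+ k.+1)^-1))%g.
  by rewrite expgS xyk !expgS !invgM !mulgA !mulgK !mulgVK.
rewrite -[X in products _ X _]addn1.
apply: productsM; first exact: products_mixedJ.
apply: products1; left; exists x => //; exists (y ^+ k.+1)%g => //.
exact: Ny.
Qed.

End MixedCommutators.

Section MixedCommutatorSubgroup.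
Variables (G : groupType) (N : groupClosed G).
Hypothesis N_normal : normal_subgroup N.
Local Notation S := (mixed_commutators N).

Lemma products_mixed_in n x : products S n x -> x \in N.
Proof.
elim: n => [|n IH] in x *.
  by case=> s [_ ->]; rewrite tuple0 big_nil gpred1.
move=> /productsS[a [z [Sa /IH Nz ->]]]; apply: gpredM => //.
have SN b : S b -> b \in N.
  by move=> [g _ [c Nc <-]]; rewrite gpredM ?gpredV //; apply: N_normal.
by have [/SN//|/SN] := Sa; rewrite gpredV.
Qed.

End MixedCommutatorSubgroup.

Section Homogeneous.
Variables (R : realType) (L : groupType).
Implicit Types (f : L -> R) (x y : L).

Lemma homogeneous1 f : homogeneous f -> f 1%g = 0.
Proof. by move=> /homogeneousX fX; have := fX 1%g 0%N; rewrite mul0r. Qed.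

Lemma homogeneousV f x : homogeneous f -> f x^-1%g = - f x.
Proof.
move=> fH; apply/eqP; rewrite -addr_eq0.
have gx : generated [set x] x by exact: (@generatedX L x 1%N).
rewrite addrC -(fH x); first by rewrite mulgV homogeneous1.
  exact/mem_set.
by apply/mem_set; apply: generatedV.
Qed.

(** The elements of a cyclic subgroup commute: the centralizer of an element commuting with [l] is a
    subgroup containing [l]. *)
Lemma commuting_additive_homogeneous f :
  (forall x y, commute x y -> f (x * y)%g = f x + f y) -> homogeneous f.
Proof.
move=> fD l x y /set_mem lx /set_mem ly; apply: fD.
have cent z : commute z l -> forall u, generated [set l] u -> commute z u.
  move=> zl u /(_ [set u | commute z u]); apply; split; last by move=> _ ->.
  split; first exact/mem_set/commute1.
  move=> a b /set_mem za /set_mem zb; apply/mem_set.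
  by apply: commuteM => //; apply: commuteV.
by apply: (cent x _ _ ly); apply/commute_sym/(cent l).
Qed.

(** Powers of commuting elements multiply termwise, which gives homogeneity. The defect at [x], [y]
    is the value of [F] at the sequence [(x * y) ^+ k * x ^- k * y ^- k], which [C] bounds. In the
    applications, [Q k] says that an element is a product of [k] commutators. *)
Lemma power_hqm (Q : nat -> L -> Prop) (C : R) (F : (nat -> L) -> R) :
  (forall u v, F (fun k => u k * v k)%g = F u + F v) ->
  (forall u, (forall k, Q k (u k)) -> `|F u| <= C) ->
  (forall x y k, Q k ((x * y) ^+ k * x ^- k * y ^- k)%g) ->
  (fun x => F (fun k => x ^+ k)%g) \in @hqm R L.
Proof.
move=> FM FC QX; apply/asboolP; split; last first.
  apply: commuting_additive_homogeneous => x y xy; rewrite -FM; congr F.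
  by apply/funext => k; rewrite expgMn.
apply/quasimorphismP; exists C => x y.
apply: le_trans (FC (fun k => (x * y) ^+ k * x ^- k * y ^- k)%g _) => //.
have FV u : F (fun k => (u k)^-1)%g = - F u.
  have F1 : F (fun=> 1%g) = 0.
    apply: (addrI (F (fun=> 1%g))); rewrite -FM addr0; congr F.
    by apply/funext => k; rewrite mulg1.
  apply/eqP; rewrite -addr_eq0 -FM -F1; apply/eqP; congr F.
  by apply/funext => k; rewrite mulVg.
by rewrite (FM (fun k => (x * y) ^+ k * x ^- k)%g) FM !FV.
Qed.

End Homogeneous.

Section InvariantQuasimorphisms.
Variables (R : realType) (G : groupType) (N : groupClosed G).
Hypothesis N_normal : normal_subgroup N.
Local Notation N' := (subgroup_type N).
Local Notation S := (mixed_commutators N).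
Implicit Types (f : N' -> R) (x y : N').

Lemma val_subM x y : val (x * y)%g = (val x * val y)%g.
Proof. exact: gmulfM. Qed.

Lemma val_subV x : val x^-1%g = (val x)^-1%g.
Proof. exact: gmulfV. Qed.

Lemma val_subX x k : val (x ^+ k)%g = (val x ^+ k)%g.
Proof. exact: gmulfXn. Qed.

Lemma invariant_hqmP f : reflect [/\ exists C, forall x y,
    `|f (x * y)%g - f x - f y| <= C, homogeneous f & Defs.invariant f]
  (f \in @invariant_hqm R G N).
Proof.
apply: (iffP andP) => [[/asboolP[/quasimorphismP fQ fH] /asboolP fI]|] //.
move=> [fQ fH fI]; split; apply/asboolP => //; split=> //.
exact/quasimorphismP.
Qed.

(** By invariance, [f] takes the same value at [g x g^-1] and [x], so it is at most [C] in absolute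
    value on a mixed commutator. Joining each letter to the rest of the word costs another [C]. *)
Lemma le_products f C n y : homogeneous f -> Defs.invariant f ->
  (forall x y, `|f (x * y)%g - f x - f y| <= C) ->
  products S n (val y) -> `|f y| <= 2 * C * n%:R.
Proof.
move=> fH fI fC; elim: n => [|n IH] in y *.
  case=> s [_]; rewrite tuple0 big_nil => y1.
  have -> : y = 1%g by apply: val_inj; rewrite y1 gmulf1.
  by rewrite homogeneous1 // normr0 mulr0.
move=> /productsS[a [z [Sa Sz yE]]].
have Nz := products_mixed_in N_normal Sz.
have Na := products_mixed_in N_normal (products1 Sa).
have letter (b : N') : S (val b) -> `|f b| <= C.
  move=> [g _ [c Nc bE]].
  pose c' : N' := Subgroup Nc; pose d' : N' := Subgroup (N_normal g Nc).
  have -> : b = (d' * c'^-1)%g by apply: val_inj; rewrite -bE val_subM val_subV.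
  have := fC d' c'^-1%g.
  by rewrite (fI g c' d' erefl) homogeneousV // opprK -addrA addNr addr0.
pose a' : N' := Subgroup Na; pose z' : N' := Subgroup Nz.
have -> : y = (a' * z')%g by apply: val_inj; rewrite yE val_subM.
have fa : `|f a'| <= C.
  have [/(letter a')//|aV] := Sa.
  by rewrite -normrN -homogeneousV //; apply: letter; rewrite val_subV.
have fz : `|f z'| <= 2 * C * n%:R by apply: IH.
have -> : f (a' * z')%g = (f (a' * z')%g - f a' - f z') + f a' + f z' by ring.
rewrite -natr1 (le_trans (ler_normD _ _)) //.
have := ler_normD (f (a' * z')%g - f a' - f z') (f a').
have := fC a' z'; lra.
Qed.

(** The elementary direction of Bavard duality: [le_products] is applied to [y ^+ k], where [f] is
    [k f(y)], and divided by [k]. *)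
Lemma le_scl f C y : homogeneous f -> Defs.invariant f ->
  (forall x y, `|f (x * y)%g - f x - f y| <= C) ->
  mixed_commutator_subgroup N (val y) -> `|f y| <= 2 * C * scl R N (val y).
Proof.
move=> fH fI fC Sy; have C0 : 0 <= C by apply: le_trans (fC 1%g 1%g).
have cvgS := cvg_scl (R := R) Sy.
apply: (cvgr_to_ge (cvgM (cvg_cst (2 * C)) cvgS)).
near=> k; have k0 : 0 < k%:R :> R.
  by rewrite ltr0n; near: k; apply: nbhs_infty_gt.
rewrite /= mulrA ler_pdivlMr // mulrC -{1}[k%:R]normr_nat -normrM.
rewrite -homogeneousX //.
apply: le_products => //; rewrite val_subX.
by apply: word_length_products; apply: generated_expg.
Unshelve. all: by end_near.
Qed.

(** By [products_expgM], [(x * y) ^+ k] is [w * y ^+ k * x ^+ k] with [w] in [G,N], where [f]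
    vanishes. Hence [k] times the error of additivity at [x], [y] is bounded by two defects,
    independently of [k]. *)
Lemma homomorphism_vanishing f : f \in @invariant_hqm R G N ->
  (forall y, mixed_commutator_subgroup N (val y) -> f y = 0) -> homomorphism f.
Proof.
move=> /invariant_hqmP[[C fC] fH _] f0 x y; apply/eqP.
rewrite -subr_eq0 opprD addrA.
apply/eqP; apply: (@natmul_bounded_eq0 _ _ (C + C)) => k.
pose w := ((x * y) ^+ k * x ^- k * y ^- k)%g.
have fw : f w = 0.
  apply: f0; apply/generatedP; exists k.
  rewrite !val_subM !val_subV !val_subX val_subM.
  by apply: products_expgM => // i; apply/gpredXn/valP.
have xyk : ((x * y) ^+ k = w * (y ^+ k * x ^+ k))%g by rewrite /w mulgA !mulgVK.
rewrite !mulrBr -!homogeneousX // xyk.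
have := fC w (y ^+ k * x ^+ k)%g; have := fC (y ^+ k)%g (x ^+ k)%g.
rewrite fw subr0 => yx wyx.
have -> : f (w * (y ^+ k * x ^+ k))%g - f (x ^+ k)%g - f (y ^+ k)%g =
  (f (y ^+ k * x ^+ k)%g - f (y ^+ k)%g - f (x ^+ k)%g) +
  (f (w * (y ^+ k * x ^+ k))%g - f (y ^+ k * x ^+ k)%g) by ring.
by rewrite (le_trans (ler_normD _ _)) // lerD.
Qed.

End InvariantQuasimorphisms.

(** * Growth of sequences of commutators *)

Lemma products_map (A B : groupType) (S : set A) (S' : set B)
    (h : {multiplicative A -> B}) n x :
  (forall a, S a -> S' (h a)) -> products S n x -> products S' n (h x).
Proof.
move=> SS'; elim: n => [|n IH] in x *.
  case=> s [_ ->]; rewrite tuple0 big_nil multiplicative1.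
  exact: products0.
move=> /productsS[a [z [Sa /IH Sz ->]]]; rewrite gmulfM -add1n.
apply: productsM Sz; apply: products1.
have [/SS'|/SS'] := Sa; first by left.
by rewrite multiplicativeV; right.
Qed.

Lemma hqm_comp (R : realType) (A B : groupType) (h : {multiplicative A -> B})
    (f : B -> R) :
  f \in @hqm R B -> f \o h \in @hqm R A.
Proof.
move=> /asboolP[/quasimorphismP[C fC] fH]; apply/asboolP; split.
  by apply/quasimorphismP; exists C => x y; rewrite /= gmulfM.
have hl l x : generated [set l] x -> h x \in generated [set h l].
  move=> /generatedP[n lx]; apply/mem_set/generatedP; exists n.
  exact: (products_map (fun a (al : [set l] a) => congr1 h al) lx).
move=> l x y /set_mem lx /set_mem ly.
by rewrite /= gmulfM (fH (h l)) // hl.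
Qed.

Lemma mixed_commutators_predT (G : groupType) (N : {pred G}) :
  mixed_commutators N `<=` mixed_commutators predT.
Proof. by move=> _ [g _ [x _ <-]]; exists g => //; exists x. Qed.

Lemma mixed_commutator_subgroup_predT (G : groupType) (N : {pred G}) y :
  mixed_commutator_subgroup N y -> mixed_commutator_subgroup predT y.
Proof.
move=> /generatedP[n Ny]; apply: (@generated_products _ _ n).
apply: (@products_map _ _ _ _ idfun _ _ _ Ny).
exact: mixed_commutators_predT.
Qed.

Definition pair_sequence (A B : groupType) : Type := nat -> A * B.

Section PairSequence.
Variables A B : groupType.
Implicit Types u v : pair_sequence A B.

HB.instance Definition _ := Choice.copy (pair_sequence A B) (nat -> A * B).

Definition pair_sequence_one : pair_sequence A B := fun=> (1%g, 1%g).
Definition pair_sequence_inv u : pair_sequence A B :=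
  fun k => ((u k).1^-1%g, (u k).2^-1%g).
Definition pair_sequence_mul u v : pair_sequence A B :=
  fun k => ((u k).1 * (v k).1, (u k).2 * (v k).2)%g.

Lemma pair_sequence_mulA : associative pair_sequence_mul.
Proof.
by move=> u v w; apply/funext => k; rewrite /pair_sequence_mul !mulgA.
Qed.

Lemma pair_sequence_mul1 : left_id pair_sequence_one pair_sequence_mul.
Proof.
move=> u; apply/funext => k; rewrite /pair_sequence_mul !mul1g.
by rewrite -surjective_pairing.
Qed.

Lemma pair_sequence_mulr1 : right_id pair_sequence_one pair_sequence_mul.
Proof.
move=> u; apply/funext => k; rewrite /pair_sequence_mul !mulg1.
by rewrite -surjective_pairing.
Qed.

Lemma pair_sequence_mulV :
  left_inverse pair_sequence_one pair_sequence_inv pair_sequence_mul.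
Proof. by move=> u; apply/funext => k; rewrite /pair_sequence_mul !mulVg. Qed.

Lemma pair_sequence_mulrV :
  right_inverse pair_sequence_one pair_sequence_inv pair_sequence_mul.
Proof. by move=> u; apply/funext => k; rewrite /pair_sequence_mul !mulgV. Qed.

HB.instance Definition _ := isGroup.Build (pair_sequence A B)
  pair_sequence_mulA pair_sequence_mul1 pair_sequence_mulr1
  pair_sequence_mulV pair_sequence_mulrV.

End PairSequence.

Section Growth.
Variables (R : realType) (G H : groupType) (K : groupClosed H) (C : R).
Hypothesis C_ge0 : 0 <= C.
Local Notation K' := (subgroup_type K).

(* [limsup C (cl_G(u_k.1) + cl_{H,K}(u_k.2)) / k <= c] *)
Definition commutator_growth (u : pair_sequence G K') (c : R) : Prop :=
  forall e, 0 < e -> \forall k \near \oo, exists m n,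
    [/\ products (mixed_commutators predT) m (u k).1,
        products (mixed_commutators K) n (val (u k).2) &
        C * (m + n)%:R <= (c + e) * k%:R].

(** The additive constant [a] is absorbed by [e * k] for large [k]. *)
Lemma commutator_growth_bounded u (c : R) (m n : nat -> nat) (a : nat) :
  (forall k, products (mixed_commutators predT) (m k) (u k).1) ->
  (forall k, products (mixed_commutators K) (n k) (val (u k).2)) ->
  (forall k, C * (m k + n k)%:R <= c * k%:R + a%:R) ->
  commutator_growth u c.
Proof.
move=> um un mn e e0; near=> k; exists (m k), (n k); split=> //.
rewrite (le_trans (mn k)) // mulrDl lerD2l mulrC -ler_pdivrMr //.
by near: k; apply: nbhs_infty_ger.
Unshelve. all: by end_near.
Qed.

Lemma commutator_growth_seminorm : commutator_null_seminorm commutator_growth.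
Proof.
split.
- move=> u v c d uc vd e e0; have e2 : 0 < e / 2 by rewrite divr_gt0.
  near=> k.
  have [m [n [um un mn]]] : exists m n,
    [/\ products (mixed_commutators predT) m (u k).1,
        products (mixed_commutators K) n (val (u k).2) &
        C * (m + n)%:R <= (c + e / 2) * k%:R] by near: k; apply: uc.
  have [m' [n' [vm vn mn']]] : exists m n,
    [/\ products (mixed_commutators predT) m (v k).1,
        products (mixed_commutators K) n (val (v k).2) &
        C * (m + n)%:R <= (d + e / 2) * k%:R] by near: k; apply: vd.
  exists (m + m')%N, (n + n')%N; split; first exact: productsM.
    by rewrite val_subM; apply: productsM.
  rewrite addnACA natrD mulrDr (le_trans (lerD mn mn')) //.
  by rewrite -mulrDl addrACA -splitr.
- move=> u c uc e /uc; apply: filterS => k [m [n [um un mn]]].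
  exists m, n; split=> //; first exact: productsV.
  by rewrite val_subV; apply: productsV.
(* At every [k], a commutator of sequences is a single commutator in each component, so its length
   is bounded and its growth is 0. *)
move=> u v; apply: (@commutator_growth_bounded _ _ (fun=> 1%N) (fun=> 1%N)
  (Num.bound (C * 2))).
- move=> k; have -> : ([~ u, v]%g k).1 = [~ (u k).1, (v k).1]%g by [].
  (* [[~ x, y]] is [x^-1 * y^-1 * x * y], hence the inverses as witnesses. *)
  apply: products1; left; exists (u k).1^-1%g => //.
  by exists (v k).1^-1%g => //; rewrite commgEl conjgE !invgK !mulgA.
- move=> k; have -> : ([~ u, v]%g k).2 = [~ (u k).2, (v k).2]%g by [].
  apply: products1; left; exists (val (u k).2^-1%g) => //.
  exists (val (v k).2^-1%g); first exact: valP.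
  by rewrite -!val_subV -!val_subM commgEl conjgE !invgK !mulgA.
by move=> k; rewrite mul0r add0r ltW // archi_boundP // mulr_ge0.
Unshelve. all: by end_near.
Qed.

End Growth.

(** * Pullback along the homomorphism and decomposition of quasimorphisms *)

Section Pullback.
Variables (R : realType) (G H : groupType).
Variables (N : groupClosed G) (K : groupClosed H).
Variables (phi : {multiplicative G -> H}).
Hypothesis phi_NK : forall x, x \in N -> phi x \in K.
Local Notation N' := (subgroup_type N).
Local Notation K' := (subgroup_type K).

Definition subgroup_map (x : N') : K' := Subgroup (phi_NK (valP x)).

Lemma subgroup_map_mul : {morph subgroup_map : x y / (x * y)%g}.
Proof.
move=> x y; apply: val_inj; rewrite [RHS]val_subM.
exact: etrans (congr1 phi (val_subM x y)) (gmulfM (val x) (val y)).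
Qed.
HB.instance Definition _ :=
  isMultiplicative.Build N' K' subgroup_map subgroup_map_mul.

Lemma products_subgroup_map n (x : N') :
  products (mixed_commutators N) n (val x) ->
  products (mixed_commutators K) n (val (subgroup_map x)).
Proof.
apply: products_map => _ [g _ [a Na <-]].
exists (phi g) => //; exists (phi a); first exact: phi_NK.
by rewrite !gmulfM !multiplicativeV.
Qed.

Lemma pullback_subproof (mu : submodule (@invariant_hqm R H K)) :
  val mu \o subgroup_map \in @invariant_hqm R G N.
Proof.
have /andP[muQ /asboolP muI] := valP mu.
apply/andP; split; first exact: hqm_comp.
apply/asboolP => g x y yx; apply: (muI (phi g)).
by rewrite /= yx !gmulfM multiplicativeV.
Qed.

Definition pullback mu := Submodule (pullback_subproof mu).

Lemma pullback_is_linear : linear pullback.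
Proof. by move=> a mu nu; apply: val_inj. Qed.
HB.instance Definition _ := GRing.isLinear.Build R _ _ _ pullback
  pullback_is_linear.

(** The witness is [chi \o phi]. Together with [pullback_H1inv], this lets [pullback] descend to a
    map from W(H,K) to W(G,N). *)
Lemma pullback_res (chi : submodule (@hqm R H)) :
  exists psi, pullback (Defs.restrict K chi) = Defs.restrict N psi.
Proof. by exists (Submodule (hqm_comp phi (valP chi))); apply: val_inj. Qed.

Lemma pullback_H1inv mu : mu \in @H1inv R H K -> pullback mu \in @H1inv R G N.
Proof.
by move=> /asboolP muH; apply/asboolP => x y /=; rewrite subgroup_map_mul muH.
Qed.

Hypotheses (N_normal : normal_subgroup N) (K_normal : normal_subgroup K).

Lemma dominated_decomposition (f : submodule (@invariant_hqm R G N)) (C : R) :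
  0 <= C ->
  (forall y : N', mixed_commutator_subgroup N (val y) ->
    `|val f y| <= C * (scl R predT (val y) + scl R K (phi (val y)))) ->
  exists psi mu, f - Defs.restrict N psi - pullback mu \in @H1inv R G N.
Proof.
move=> C0 f_le; have [[D fD] fH fI] := invariant_hqmP _ (valP f).
(* [T] is the graph of the functional to extend: [c] is the limit of f(x_k)/k, and only sequences
   for which this limit exists are in its domain. *)
pose T (u : pair_sequence G K') (c : R) := exists x : nat -> N',
  [/\ forall k, mixed_commutator_subgroup N (val (x k)),
      u = (fun k => (val (x k), subgroup_map (x k))) &
      forall e, 0 < e ->
        \forall k \near \oo, `|val f (x k) - c * k%:R| <= e * k%:R].
have seminormP := commutator_growth_seminorm G K C0.
have [||| F [FM FT FP]] := hahn_banach_group seminormP (T := T).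
- exists (fun=> 1%g); split.
  + by move=> k; apply/generatedP; exists 0%N; apply: products0.
  + apply/funext => k; rewrite !multiplicative1.
    by [].
  move=> e e0; apply: nearW => k.
  by rewrite homogeneous1 // mul0r subrr normr0 mulr_ge0 // ltW.
- move=> _ _ c d [x [xS -> xc]] [y [yS -> yd]];
  exists (fun k => x k / y k)%g; split.
  + move=> k; rewrite val_subM val_subV.
    exact: generatedM (xS k) (generatedV (yS k)).
  + by apply/funext => k; rewrite val_subM val_subV gmulfM multiplicativeV.
  (* One third of [e] goes to each of the two sequences, and one third to the defect [D], which is
     negligible against [k]. *)
  move=> e e0; have e3 : 0 < e / 3 by rewrite divr_gt0.
  near=> k.
  have kx : `|val f (x k) - c * k%:R| <= e / 3 * k%:R by near: k; apply: xc.
  have ky : `|val f (y k) - d * k%:R| <= e / 3 * k%:R by near: k; apply: yd.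
  have kD : D <= e / 3 * k%:R.
    by rewrite -ler_pdivrMl //; near: k; apply: nbhs_infty_ger.
  have := fD (x k) (y k)^-1%g; rewrite homogeneousV // => xy.
  have -> : val f (x k / y k)%g - (c - d) * k%:R =
    (val f (x k / y k)%g - val f (x k) - - val f (y k)) +
    ((val f (x k) - c * k%:R) - (val f (y k) - d * k%:R)) by ring.
  rewrite (le_trans (ler_normD _ _)) //.
  have := ler_normB (val f (x k) - c * k%:R) (val f (y k) - d * k%:R).
  lra.
- move=> _ c d [x [xS -> xc]] Pd; apply/ler_addgt0Pr => e e0.
  have e2 : 0 < e / 2 by rewrite divr_gt0.
  near \oo => k.
  have k0 : 0 < k%:R :> R.
    by rewrite ltr0n; near: k; apply: nbhs_infty_gt.
  have kx : `|val f (x k) - c * k%:R| <= e / 2 * k%:R by near: k; apply: xc.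
  have [m [n [/= xm xn mn]]] : exists m n,
    [/\ products (mixed_commutators predT) m (val (x k)),
        products (mixed_commutators K) n (val (subgroup_map (x k))) &
        C * (m + n)%:R <= (d + e / 2) * k%:R] by near: k; apply: Pd.
  rewrite -(ler_pM2r k0).
  (* The hypothesis on [f] bounds it by stable lengths, and these are at most the lengths of the
     given words. *)
  have fk : `|val f (x k)| <= C * (m + n)%:R.
    rewrite (le_trans (f_le _ (xS k))) // ler_wpM2l // natrD.
    by apply: lerD; apply: scl_le_products.
  move: kx fk mn; rewrite !ler_norml => /andP[+ _] /andP[_ +]; lra.
have F1 : F 1%g = 0 by apply: (addrI (F 1%g)); rewrite -FM mulg1 addr0.
have FV u : F u^-1%g = - F u.
  by apply/eqP; rewrite -addr_eq0 -FM mulVg F1.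
have F_norm u c : commutator_growth C u c -> `|F u| <= c.
  move=> uc; rewrite ler_norml FP // andbT lerNl -FV FP //.
  exact: seminormV seminormP _ _ uc.
pose psi := fun g : G => F (fun k => (g ^+ k, 1)%g).
have psiQ : psi \in @hqm R G.
  apply: (@power_hqm _ _ (products (mixed_commutators predT)) C
    (fun u => F (fun k => (u k, 1%g)))).
  - move=> u v; rewrite -FM; congr F; apply/funext => k.
    by congr pair; rewrite mulg1.
  (* At index [k] there are [k] commutators in the first component and none in the second, so the
     growth is at most [C]. *)
  - move=> u uP; apply: F_norm.
    apply: (@commutator_growth_bounded _ _ _ _ _ _ _ id (fun=> 0%N) 0%N) => //.
    + by move=> k; apply: products0.
    + by move=> k; rewrite addn0 addr0.
  by move=> x y k; apply: products_expgM.
pose mu := fun h : K' => F (fun k => (1, h ^+ k)%g).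
have muQ : mu \in @invariant_hqm R H K.
  apply/andP; split.
    apply: (@power_hqm _ _
      (fun n h => products (mixed_commutators K) n (val h)) C
      (fun u => F (fun k => (1%g, u k)))).
    - move=> u v; rewrite -FM; congr F; apply/funext => k.
      by congr pair; rewrite mulg1.
    - move=> u uP; apply: F_norm.
      apply: (@commutator_growth_bounded _ _ _ _ _ _ _ (fun=> 0%N) id
        0%N) => //.
      + by move=> k; apply: products0.
      + by move=> k; rewrite add0n addr0.
    move=> x y k; rewrite !val_subM !val_subV !val_subX val_subM.
    by apply: products_expgM => // i; apply/gpredXn/valP.
  (* [(g x g^-1)^k x^-k] is a single mixed commutator, that of [g] and [x^k]. The sequence of these
     elements has growth 0, so [F] vanishes on it. *)
  apply/asboolP => g x y yx; apply/eqP; rewrite -subr_eq0 -normr_le0 -FV -FM.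
  apply: F_norm.
  apply: (@commutator_growth_bounded _ _ _ _ _ _ _ (fun=> 0%N) (fun=> 1%N)
    (Num.bound (C * 1))) => //=.
  - by move=> k; rewrite invg1 mulg1; apply: products0.
  - move=> k; apply: products1; left; exists g => //.
    exists (val x ^+ k)%g; first exact/gpredXn/valP.
    transitivity (val (y ^+ k / x ^+ k)%g); last by [].
    rewrite val_subM val_subV !val_subX yx; congr (_ * _)%g.
    elim: k => [|k IH]; first by rewrite !expg0 mulg1 mulgV.
    by rewrite !expgS -IH !mulgA mulgVK.
  by move=> k; rewrite mul0r add0r ltW // archi_boundP // mulr_ge0.
exists (Submodule psiQ), (Submodule muQ); apply/asboolP.
(* It remains to compare values on [G,N]. There [(y^k, 1)] times [(1, phi(y)^k)] is
   [(y^k, phi(y)^k)], where [F] is prescribed by [T] to be the limit of f(y^k)/k, that is f(y). *)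
apply: homomorphism_vanishing => //; first exact: valP.
move=> y yS; rewrite /= !fctE /= -addrA -opprD -FM; apply/eqP; rewrite subr_eq0.
apply/eqP/esym/FT; exists (fun k => y ^+ k)%g; split.
- by move=> k; rewrite val_subX; apply: generated_expg.
- apply/funext => k; rewrite val_subX; congr pair; first by rewrite mulg1.
  rewrite mul1g; apply: val_inj.
  by rewrite val_subX /= val_subX multiplicativeX.
move=> e e0; apply: nearW => k.
by rewrite homogeneousX // mulrC subrr normr0 mulr_ge0 // ltW.
Unshelve. all: by end_near.
Qed.

End Pullback.

(** * Comparison of dimensions and conclusion *)

(** By the decomposition, the pullbacks of representatives of a basis of W(H,K) span W(G,N). *)
Lemma dimension_W_le (R : realType) (G H : groupType)
    (N : groupClosed G) (K : groupClosed H) (phi : {multiplicative G -> H})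
    (phi_NK : forall x, x \in N -> phi x \in K) :
  finite_dimensional (@W R H K) ->
  (forall f : submodule (@invariant_hqm R G N), exists psi mu,
    f - Defs.restrict N psi - pullback phi_NK mu \in @H1inv R G N) ->
  (dimension (@W R G N) <= dimension (@W R H K))%E.
Proof.
move=> [n [v vB]] dec; have [_ v_span] := vB.
pose piK mu : @W R H K := \pi_(quotient (@H1inv_plus_res R H K))%qT mu.
pose piN f : @W R G N := \pi_(quotient (@H1inv_plus_res R G N))%qT f.
pose w i := piN (pullback phi_NK (repr (v i))).
have pi_lin (G' : groupType) (N' : groupClosed G') I (r : seq I)
    (c : I -> R) (F : I -> submodule (@invariant_hqm R G' N')) :
    \pi_(quotient (@H1inv_plus_res R G' N'))%qT (\sum_(i <- r) c i *: F i) =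
    \sum_(i <- r) c i *: \pi_(quotient (@H1inv_plus_res R G' N'))%qT (F i).
  elim: r => [|i r IH]; first by rewrite !big_nil pi_quotient0.
  by rewrite !big_cons pi_quotientD pi_quotientZ IH.
have w_span : spanning w.
  move=> q; have [psi [mu f_dec]] := dec (repr q).
  have [c cE] := v_span (piK mu); exists c.
  (* [mu] agrees with a combination of the representatives only up to a homomorphism [h] and a
     restriction of [chi]; both have to be carried through the pullback. *)
  have /quot_eqP/asboolP[h [chi [hH muE]]] :
      piK mu = piK (\sum_i c i *: repr (v i)).
    rewrite cE /piK pi_lin; apply: eq_bigr => i _; congr (_ *: _).
    by rewrite [RHS]reprK.
  have [psi' resE] := pullback_res phi_NK chi.
  have -> : q = piN (repr q) by rewrite /piN [RHS]reprK.
  rewrite -pi_lin; apply/quot_eqP/asboolP.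
  (* The homomorphism part collects the error of the decomposition and the pullback of [h]; the
     restriction part collects [psi] and the pullback of [chi]. *)
  exists (repr q - Defs.restrict N psi - pullback phi_NK mu +
    pullback phi_NK h).
  exists (psi + psi'); split.
    by apply: rpredD => //; apply: pullback_H1inv.
  have -> : Defs.restrict N (psi + psi') =
      Defs.restrict N psi + pullback phi_NK (Defs.restrict K chi).
    by rewrite resE; apply: val_inj.
  have -> : \sum_i c i *: pullback phi_NK (repr (v i)) =
      pullback phi_NK (\sum_i c i *: repr (v i)).
    by rewrite linear_sum; apply: eq_bigr => i _; rewrite linearZ.
  have -> : pullback phi_NK mu = pullback phi_NK (\sum_i c i *: repr (v i)) +
      (pullback phi_NK h + pullback phi_NK (Defs.restrict K chi)).
    by rewrite -!raddfD -muE addrC subrK.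
  by rewrite -[RHS]addrA [in RHS](addrCA (pullback phi_NK h)) [RHS]addrACA
    subrK opprD subrK.
have [m mn [b bB]] := spanning_basis w_span.
by rewrite (dimension_basis bB) (dimension_basis vB) lee_fin ler_nat.
Qed.

(** The hypotheses force [a n > 0], so the quotient is [+oo] where [b n] vanishes; elsewhere it
    exceeds [n]. *)
Lemma ratio_cvg_pinfty (R : realType) (a b : nat -> R) :
  (forall n, 0 <= b n) -> (forall n, n%:R * b n < a n) ->
  ((a n)%:E / (b n)%:E)%E @[n --> \oo] --> +oo%E.
Proof.
move=> b0 ab; apply/cvgeyPge => A; near=> n.
have An : A <= n%:R by near: n; apply: nbhs_infty_ger.
have a0 : 0 < a n by apply: le_lt_trans (ab n); rewrite mulr_ge0.
have [bn|bn] := eqVneq (b n) 0.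
  by rewrite bn inve0 gt0_muley ?lte_fin // leey.
rewrite inver (negPf bn) -EFinM lee_fin (le_trans An) //.
by rewrite ler_pdivlMr ?lt_def ?bn ?b0 // ltW.
Unshelve. all: by end_near.
Qed.

Theorem theorem6p1 (R : realType) (G H : groupType)
  (N : groupClosed G) (K : groupClosed H)
  (N_normal : normal_subgroup N) (K_normal : normal_subgroup K)
  (res_closed : closed (range (@res_hat R G N)))
  (W_fin : finite_dimensional (@W R H K))
  (W_gt : (dimension (@W R G N) > dimension (@W R H K))%E)
  (phi : {multiplicative G -> H})
  (phi_NK : forall x, x \in N -> phi x \in K) :
  exists y : nat -> G,
    [/\ forall n, mixed_commutator_subgroup N (y n),
        ((scl R N (y n))%:E / (scl R predT (y n))%:E)%E
          @[n --> \oo] --> +oo%E &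
        ((scl R N (y n))%:E / (scl R K (phi (y n)))%:E)%E
          @[n --> \oo] --> +oo%E].
Proof.
have scl_G y : mixed_commutator_subgroup N y -> 0 <= scl R predT y.
  by move=> /mixed_commutator_subgroup_predT; apply: scl_ge0.
(* Nonnegativity relies on the existence of the limit, hence on [phi y] being in [H,K]: [phi] sends
   words in mixed commutators to such words. *)
have scl_K y : mixed_commutator_subgroup N y -> 0 <= scl R K (phi y).
  move=> /generatedP[n Ny]; apply: scl_ge0; apply/generatedP; exists n.
  exact: (products_subgroup_map phi_NK
    (x := Subgroup (products_mixed_in N_normal Ny))).
have [[M M_ub]|unb] := pselect (exists M : nat, forall y,
    mixed_commutator_subgroup N y ->
    scl R N y <= M%:R * (scl R predT y + scl R K (phi y))).
  suff : (dimension (@W R G N) <= dimension (@W R H K))%E by rewrite leNgt W_gt.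
  apply: (dimension_W_le (phi_NK := phi_NK)) => // f.
  have [[C fC] fH fI] := invariant_hqmP _ (valP f).
  have C0 : 0 <= C by apply: le_trans (fC 1%g 1%g).
  (* The factor [2 * C] comes from [le_scl], and [M] from the assumed comparison of stable
     lengths. *)
  apply: (@dominated_decomposition _ _ _ _ _ _ phi_NK _ _ _
    (2 * C * M%:R)) => //.
    by rewrite !mulr_ge0.
  move=> y yS; apply: le_trans (le_scl N_normal fH fI fC yS) _.
  by rewrite -[leRHS]mulrA ler_wpM2l ?mulr_ge0 // M_ub.
(* [y n] violates the comparison with constant [n]. Since both terms on the right are nonnegative,
   the strict inequality holds for each of them separately. *)
have /choice[y yP] : forall n : nat, exists y, mixed_commutator_subgroup N y /\
    n%:R * (scl R predT y + scl R K (phi y)) < scl R N y.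
  move=> n; apply: contrapT => ny; apply: unb; exists n => y yS.
  by rewrite leNgt; apply/negP => ylt; apply: ny; exists y.
have yS n := (yP n).1.
exists y; split=> //; apply: ratio_cvg_pinfty => n.
- exact: scl_G.
- by apply: le_lt_trans (yP n).2; rewrite ler_wpM2l // lerDl scl_K.
- exact: scl_K.
- by apply: le_lt_trans (yP n).2; rewrite ler_wpM2l // lerDr scl_G.
Qed.
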